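(* For every integer $n\ge1$, the cover pebbling number $\lambda(S_n)$ of the Sierpiński gasket graph $S_n$ satisfies the recursion $$\lambda(S_{n+1})=\left(1+2^{2^{n-1}+1}\right)\lambda(S_n)-\left(2^{2^n}+2^{2^{n-1}+1}\right).$$
   Context: The Sierpiński gasket graph $S_n$ ($n\ge1$) is the finite simple graph whose vertices are the intersection points of the line segments in the $n$-th finite stage of the Sierpiński gasket and whose edges are the segments joining consecutive such points. Equivalently, it is defined recursively as follows. $S_1$ is a triangle ($K_3$), with its three vertices designated as the top, left and right corner vertices. For $n\ge1$, $S_{n+1}$ is obtained from three disjoint copies $S_{n+1,T}$ (top), $S_{n+1,L}$ (bottom left), $S_{n+1,R}$ (bottom right) of $S_n$ by identifying the left corner of $S_{n+1,T}$ with the top corner of $S_{n+1,L}$, the right corner of $S_{n+1,T}$ with the top corner of $S_{n+1,R}$, and the right corner of $S_{n+1,L}$ with the left corner of $S_{n+1,R}$. The top, left and right corners of $S_{n+1}$ are the top corner of $S_{n+1,T}$, the left corner of $S_{n+1,L}$ and the right corner of $S_{n+1,R}$, respectively. A configuration of weight $t$ on a connected graph $G$ is a function $C:V(G)\to\mathbb{N}\cup\{0\}$ with $\sum_{v\in V(G)}C(v)=t$ ($C(v)$ is the number of pebbles on $v$). A pebbling move removes two pebbles from some vertex and places one of them on an adjacent vertex (the other is discarded). The cover pebbling number $\lambda(G)$ is the minimum number such that, given any initial configuration of at least $\lambda(G)$ pebbles on $G$, it is possible to make a (finite) series of pebbling moves after which every vertex of $G$ simultaneously has at least one pebble. *)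

(* Defs.v *)
From Stdlib Require Import Relations.
From mathcomp Require Import all_boot.
From mathcomp Require Import boolp classical_sets.

Set Implicit Arguments.
Unset Strict Implicit.
Unset Printing Implicit Defensive.

Record corner_graph := CornerGraph {
  vertex :> finType;
  edge : rel vertex;
  top_corner : vertex;
  left_corner : vertex;
  right_corner : vertex }.
Arguments edge : clear implicits.

Definition triangle : corner_graph :=
  @CornerGraph 'I_3 (fun x y => x != y)
    (@Ordinal 3 0 isT) (@Ordinal 3 1 isT) (@Ordinal 3 2 isT).

Section Glue.
Variable G : corner_graph.

Definition copies : finType := (G + G + G)%type.
Definition in_top (v : G) : copies := inl (inl v).
Definition in_left (v : G) : copies := inl (inr v).
Definition in_right (v : G) : copies := inr v.

Definition copies_edge (x y : copies) : bool :=
  match x, y with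
  | inl (inl u), inl (inl v) => edge G u v
  | inl (inr u), inl (inr v) => edge G u v
  | inr u, inr v => edge G u v
  | _, _ => false
  end.

Definition corner_pairs : seq (copies * copies) :=
  [:: (in_top (left_corner G), in_left (top_corner G));
      (in_top (right_corner G), in_right (top_corner G));
      (in_left (right_corner G), in_right (left_corner G))].

Definition identified (x y : copies) : bool :=
  ((x, y) \in corner_pairs) || ((y, x) \in corner_pairs).

Lemma identified_sym : connect_sym identified.
Proof. by apply: sym_connect_sym => x y; rewrite /identified orbC. Qed.

(* The quotient of the disjoint union by the equivalence relation generated by
   [identified]; each class is represented by its canonical element
   [root identified x]. *)
Definition glued_vertex : finType := {x : copies | roots identified x}.

Definition glue_class (x : copies) : glued_vertex :=
  exist _ (root identified x) (roots_root identified_sym x).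

Definition glue : corner_graph :=
  @CornerGraph glued_vertex
    (fun p q => [exists x, exists y,
       [&& copies_edge x y, glue_class x == p & glue_class y == q]])
    (glue_class (in_top (top_corner G)))
    (glue_class (in_left (left_corner G)))
    (glue_class (in_right (right_corner G))).

End Glue.

(* [sierpinski n] is S_n for n >= 1 ([sierpinski 0] is a dummy value, again
   the triangle). *)
Definition sierpinski (n : nat) : corner_graph := iter n.-1 glue triangle.

Definition graph_connected (V : finType) (e : rel V) : Prop :=
  forall u v, connect e u v.

Section Pebbling.
Variables (V : finType) (e : rel V).

Definition configuration := {ffun V -> nat}.

Definition weight (C : configuration) : nat := \sum_v C v.

Definition pebbling_move (C C' : configuration) : Prop :=
  exists u v : V, [/\ e u v, 2 <= C u &
    C' = [ffun w => C w - 2 * (w == u) + (w == v)]].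

Definition pebbling_moves : relation configuration :=
  clos_refl_trans configuration pebbling_move.

Definition coverable (C : configuration) : Prop :=
  exists C', pebbling_moves C C' /\ forall v, 1 <= C' v.

Definition covers_from (N : nat) : Prop :=
  forall C, N <= weight C -> coverable C.

Definition is_cover_pebbling_number (N : nat) : Prop :=
  covers_from N /\ forall M, covers_from M -> N <= M.

(* Meaningful for connected graphs, see [cover_pebbling_numberP] below. *)
Definition cover_pebbling_number : nat := xget 0 is_cover_pebbling_number.

End Pebbling.

Section WellDefined.
Variables (V : finType) (e : rel V).
Implicit Types C D : configuration V.

Let addc C D : configuration V := [ffun w => C w + D w].
Let single (k : nat) (u : V) : configuration V := [ffun w => k * (w == u)].

Let addcC C D : addc C D = addc D C.
Proof. by apply/ffunP => w; rewrite !ffunE addnC. Qed.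

Let moves_trans C2 C1 C3 : pebbling_moves e C1 C2 -> pebbling_moves e C2 C3 ->
  pebbling_moves e C1 C3.
Proof. exact: rt_trans. Qed.

Let moves_addr D C C' :
  pebbling_moves e C C' -> pebbling_moves e (addc C D) (addc C' D).
Proof.
elim=> [{}C {}C' [u [v [euv Cu ->]]]|{}C|C1 C2 C3 _ H1 _ H2].
- apply: rt_step; exists u, v; split => //; first by rewrite ffunE ltn_addr.
  apply/ffunP => w; rewrite !ffunE.
  case: (eqVneq w u) => [->|_]; last by rewrite !muln0 !subn0 addnAC.
  by rewrite !muln1 addnAC addnBAC.
- exact: rt_refl.
- exact: moves_trans H1 H2.
Qed.

Let moves_addc C C' D D' : pebbling_moves e C C' -> pebbling_moves e D D' ->
  pebbling_moves e (addc C D) (addc C' D').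
Proof.
move=> HC HD; apply: moves_trans (moves_addr D HC) _.
by rewrite ![addc C' _]addcC; apply: moves_addr.
Qed.

Let single_step u v k : irreflexive e -> e u v ->
  pebbling_moves e (single (2 * k) u) (single k v).
Proof.
move=> irr euv; have neq_uv : u != v by apply: contraTneq euv => ->; rewrite irr.
elim: k => [|k IHk].
  suff -> : single (2 * 0) u = single 0 v by exact: rt_refl.
  by apply/ffunP => w; rewrite !ffunE.
have -> : single (2 * k.+1) u = addc (single 2 u) (single (2 * k) u).
  by apply/ffunP => w; rewrite !ffunE mulnS mulnDl.
have -> : single k.+1 v = addc (single 1 v) (single k v).
  by apply/ffunP => w; rewrite !ffunE mulSn mul1n.
apply: moves_addc IHk; apply: rt_step; exists u, v; split => //.
  by rewrite ffunE eqxx.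
by apply/ffunP => w; rewrite !ffunE subnn add0n mul1n.
Qed.

Let single_path u p : irreflexive e -> path e u p ->
  pebbling_moves e (single (2 ^ size p) u) (single 1 (last u p)).
Proof.
move=> irr; elim: p u => [|v p IHp] u /=; first by move=> _; exact: rt_refl.
case/andP => euv /IHp; apply: moves_trans.
by rewrite expnS; apply: single_step.
Qed.

Let cover_from_vertex u : irreflexive e -> graph_connected e ->
  exists K, pebbling_moves e (single K u) [ffun=> 1].
Proof.
move=> irr conn.
have [K HK] : exists K, pebbling_moves e (single K u)
    [ffun w => count_mem w (enum V)].
  elim: (enum V) => [|v s [K HK]].
    exists 0; suff -> : single 0 u = [ffun w => count_mem w [::]] by exact: rt_refl.
    by apply/ffunP => w; rewrite !ffunE.
  have /connectP [p pP lastp] := conn u v.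
  exists (2 ^ size p + K).
  have -> : single (2 ^ size p + K) u = addc (single (2 ^ size p) u) (single K u).
    by apply/ffunP => w; rewrite !ffunE mulnDl.
  have -> : [ffun w => count_mem w (v :: s)] =
      addc (single 1 v) [ffun w => count_mem w s].
    by apply/ffunP => w; rewrite !ffunE /= mul1n eq_sym.
  by apply: moves_addc HK; rewrite lastp; apply: single_path.
exists K; suff -> : [ffun=> 1] = [ffun w => count_mem w (enum V)] :> configuration V by [].
by apply/ffunP => w; rewrite !ffunE count_uniq_mem ?enum_uniq // mem_enum.
Qed.

Lemma covers_from_exists : irreflexive e -> graph_connected e ->
  exists N, covers_from e N.
Proof.
move=> irr conn.
have [K HK] := fin_all_exists (fun u => cover_from_vertex u irr conn).
exists (\sum_u K u).+1 => C ltC.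
have [/existsP [u Ku]|] := boolP [exists u, K u <= C u]; last first.
  rewrite negb_exists => /forallP ltK; move: ltC; rewrite ltnNge; case/negP.
  by apply: leq_sum => u _; rewrite ltnW // ltnNge ltK.
exists (addc [ffun=> 1] [ffun w => C w - single (K u) u w]); split; last first.
  by move=> v; rewrite !ffunE.
suff {1}-> : C = addc (single (K u) u) [ffun w => C w - single (K u) u w].
  exact: moves_addr.
apply/ffunP => w; rewrite !ffunE subnKC //.
by case: (eqVneq w u) => [->|_]; rewrite ?muln1 ?muln0.
Qed.

Lemma cover_pebbling_numberP : irreflexive e -> graph_connected e ->
  is_cover_pebbling_number e (cover_pebbling_number e).
Proof.
move=> irr conn; apply: xgetPex.
have [N0 HN0] := covers_from_exists irr conn.
have exN : exists N, `[< covers_from e N >] by exists N0; apply/asboolP.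
exists (ex_minn exN); case: ex_minnP => N /asboolP HN minN.
by split=> // M /asboolP /minN.
Qed.

End WellDefined.

Definition distinct_corners (G : corner_graph) : bool :=
  uniq [:: top_corner G; left_corner G; right_corner G].

Section GlueFacts.
Variable G : corner_graph.
Hypothesis corners : distinct_corners G.

Lemma glue_class_eq (x y : copies G) :
  (glue_class x == glue_class y) = (x == y) || identified x y.
Proof.
rewrite -val_eqE /= root_connect; last exact: identified_sym.
apply/idP/idP; last by case/predU1P => [->|/connect1].
case/connectP => p; elim: p x => [|z p IHp] x /=; first by move=> _ ->; rewrite eqxx.
case/andP => xz zp lasty; have {IHp zp lasty} := IHp _ zp lasty.
case/predU1P => [<-|]; first by rewrite xz orbT.
move: xz corners; rewrite /distinct_corners /= !inE negb_or andbT.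
move=> xz /andP [/andP [/eqP tl /eqP tr] /eqP lr] zy.
suff -> : x = y by rewrite eqxx.
move: xz zy; rewrite /identified !inE /in_top /in_left /in_right.
by case/orP => /or3P [] /eqP [] -> -> /orP [] /or3P [] /eqP [] *; congruence.
Qed.

Lemma glue_distinct_corners : distinct_corners (glue G).
Proof.
move: corners; rewrite /distinct_corners /= !inE !negb_or !andbT.
case/andP => /andP [/eqP tl /eqP tr] /eqP lr; rewrite !glue_class_eq.
rewrite /identified !inE -!negb_or; apply/negP; rewrite /in_top /in_left /in_right.
by case/orP => [/orP [] | ] /orP [/eqP | /orP [] /or3P [] /eqP] []; congruence.
Qed.

Lemma glue_edge_irr : irreflexive (edge G) -> irreflexive (edge (glue G)).
Proof.
move: corners; rewrite /distinct_corners /= !inE !negb_or !andbT.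
move=> /andP [/andP [/eqP tl /eqP tr] /eqP lr] irr p /=.
apply/existsP => -[x /existsP [y /and3P [exy /eqP <-]]].
rewrite glue_class_eq /identified !inE => /orP [/eqP eyx|].
  by move: exy; rewrite eyx; case: x {eyx} => [[]|] u /=; rewrite irr.
by case/orP => /or3P [] /eqP [] yE xE; move: exy; rewrite yE xE.
Qed.

Lemma glue_edge_sym : symmetric (edge G) -> symmetric (edge (glue G)).
Proof.
move=> symG; have sub p q : edge (glue G) p q -> edge (glue G) q p.
  case/existsP => x /existsP [y /and3P [exy px qy]].
  apply/existsP; exists y; apply/existsP; exists x; rewrite qy px !andbT.
  by case: x y exy {px qy} => [[x|x]|x] [[y|y]|y] //=; rewrite symG.
by move=> p q; apply/idP/idP; apply: sub.
Qed.

Lemma glue_connected :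
  graph_connected (edge G) -> graph_connected (edge (glue G)).
Proof.
move=> conn.
have copy (f : G -> copies G) u v :
    (forall a b, edge G a b -> copies_edge (f a) (f b)) ->
    connect (edge (glue G)) (glue_class (f u)) (glue_class (f v)).
  move=> fE; have /connectP [p pP ->] := conn u v.
  elim: p u pP => [|w p IHp] u /=; first by rewrite connect0.
  case/andP => uw /IHp; apply: connect_trans; apply: connect1.
  apply/existsP; exists (f u); apply/existsP; exists (f w).
  by rewrite fE ?eqxx.
have cT u v := @copy (@in_top G) u v (fun _ _ => id).
have cL u v := @copy (@in_left G) u v (fun _ _ => id).
have cR u v := @copy (@in_right G) u v (fun _ _ => id).
have glueE x y : identified x y -> glue_class x = glue_class y.
  move=> xy; apply/val_inj/eqP.
  by rewrite /= root_connect ?connect1 //; apply: identified_sym.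
have TL : glue_class (in_top (left_corner G)) = glue_class (in_left (top_corner G)).
  by apply: glueE; rewrite /identified !inE eqxx.
have TR : glue_class (in_top (right_corner G)) = glue_class (in_right (top_corner G)).
  by apply: glueE; rewrite /identified !inE eqxx !orbT.
have LR : glue_class (in_left (right_corner G)) = glue_class (in_right (left_corner G)).
  by apply: glueE; rewrite /identified !inE eqxx !orbT.
have surj (p : glue G) : exists x, p = glue_class x.
  by exists (val p); apply/val_inj/esym/eqP; apply: (valP p).
move=> p q; have [x ->] := surj p; have [y ->] := surj q.
case: x => [[x|x]|x]; case: y => [[y|y]|y];
  rewrite -?/(in_top _) -?/(in_left _) -?/(in_right _).
- exact: cT.
- by apply: connect_trans (cT x (left_corner G)) _; rewrite TL.
- by apply: connect_trans (cT x (right_corner G)) _; rewrite TR.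
- by apply: connect_trans (cL x (top_corner G)) _; rewrite -TL.
- exact: cL.
- by apply: connect_trans (cL x (right_corner G)) _; rewrite LR.
- by apply: connect_trans (cR x (top_corner G)) _; rewrite -TR.
- by apply: connect_trans (cR x (left_corner G)) _; rewrite -LR.
- exact: cR.
Qed.

End GlueFacts.

Lemma sierpinski_corners n : distinct_corners (sierpinski n).
Proof.
by rewrite /sierpinski; elim: n.-1 => [|m IH] //=; apply: glue_distinct_corners.
Qed.

Lemma sierpinski_edge_sym n : symmetric (edge (sierpinski n)).
Proof.
rewrite /sierpinski; elim: n.-1 => [|m IH] /=; last exact: glue_edge_sym.
by move=> x y; rewrite /= eq_sym.
Qed.

Lemma sierpinski_edge_irr n : irreflexive (edge (sierpinski n)).
Proof.
rewrite /sierpinski; elim: n.-1 => [|m IH] /=; first by move=> x; rewrite /= eqxx.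
by apply: glue_edge_irr IH; apply: (sierpinski_corners m.+1).
Qed.

Lemma sierpinski_connected n : graph_connected (edge (sierpinski n)).
Proof.
rewrite /sierpinski; elim: n.-1 => [|m IH] /=; last exact: glue_connected.
by move=> x y; case: (eqVneq x y) => [->|xy]; [apply: connect0 | apply: connect1].
Qed.

(* Main.v *)
From Stdlib Require Import Relations.
From mathcomp Require Import boolp classical_sets.
Require Import Defs.
From mathcomp Require Import all_boot all_order all_algebra.
From mathcomp Require Import zify.

Set Implicit Arguments.
Unset Strict Implicit.
Unset Printing Implicit Defensive.

(* By Sjöstrand's stacking theorem, the worst configuration of a connected
   graph puts all pebbles on one vertex v, which costs sum_u 2^d(v,u). In S_n
   every vertex is within D = 2^(n-1) of each corner and the corners are at
   distance D from one another. A vertex of a copy of S_n in S_(n+1) thus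
   reaches the other two copies through corners at distance at most D, so its
   cost is at most that of a corner of S_(n+1), where all these bounds are
   equalities; the subtracted terms account for the three identified vertices. *)

(** * Walks and distances in a connected graph *)

Section Distance.
Variables (V : finType) (e : rel V).

Definition walk u v k := exists p, [/\ path e u p, last u p = v & size p = k].

(** The default 0 of [xget] is never reached in a connected graph, where some walk from [u] to [v]
    exists. *)
Definition dist u v : nat :=
  xget 0 (fun k => walk u v k /\ forall j, walk u v j -> k <= j).

Definition stack_cost v := \sum_u 2 ^ dist v u.

Hypothesis conn : graph_connected e.

Lemma dist_spec u v :
  walk u v (dist u v) /\ forall j, walk u v j -> dist u v <= j.
Proof.
apply: (@xgetPex _ 0 (fun k => walk u v k /\ forall j, walk u v j -> k <= j)).
have exk : exists k, `[< walk u v k >].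
  by have /connectP[p pP ->] := conn u v; exists (size p); apply/asboolP; exists p.
exists (ex_minn exk); case: ex_minnP => k /asboolP uvk mink.
by split=> // j /asboolP /mink.
Qed.

Lemma dist_walk u v : walk u v (dist u v).
Proof. exact: (dist_spec u v).1. Qed.

Lemma dist_le u v k : walk u v k -> dist u v <= k.
Proof. exact: (dist_spec u v).2. Qed.

Lemma walk_cat u v w j k : walk u v j -> walk v w k -> walk u w (j + k).
Proof.
move=> [p [pP pv <-]] [q [qP qw <-]]; exists (p ++ q).
by rewrite cat_path last_cat size_cat pv pP qP.
Qed.

Lemma dist_triangle v u w : dist u w <= dist u v + dist v w.
Proof. by apply/dist_le/walk_cat; apply: dist_walk. Qed.

Lemma distvv u : dist u u = 0.
Proof. by apply/eqP; rewrite -leqn0; apply: dist_le; exists [::]. Qed.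

Lemma dist_edge u v : e u v -> dist u v <= 1.
Proof. by move=> euv; apply: dist_le; exists [:: v]; rewrite /= euv. Qed.

Lemma dist_gt0 u v : u != v -> 0 < dist u v.
Proof.
rewrite lt0n; apply: contraNneq => duv; have [[|w p] [_ /= uv]] := dist_walk u v.
  by rewrite uv.
by rewrite duv.
Qed.

(** Removing repetitions from a shortest walk cannot lengthen it, so its length is still the
    distance. *)
Lemma geodesic u v :
  exists p, [/\ path e u p, last u p = v, uniq (u :: p) & size p = dist u v].
Proof.
have [p [pP pv psize]] := dist_walk u v; move: pv psize.
have [q qP uniqq subqp] := shortenP pP => qv psize.
exists q; split=> //; apply/eqP; rewrite eqn_leq dist_le ?andbT; last by exists q.
by rewrite -psize uniq_leq_size //; case/andP: uniqq.
Qed.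

Lemma walk_take u p x0 i : path e u p -> i < size p -> walk u (nth x0 p i) i.+1.
Proof.
move=> pP ip; exists (take i.+1 p); split; first exact: take_path.
  by rewrite (take_nth x0) // last_rcons.
by rewrite size_takel.
Qed.

Lemma walk_drop u p x0 i : path e u p -> i < size p ->
  walk (nth x0 p i) (last u p) (size p - i.+1).
Proof.
move=> pP ip; exists (drop i.+1 p); rewrite size_drop; split=> //.
  move: pP; rewrite -{1}(cat_take_drop i.+1 p) cat_path => /andP[_].
  by rewrite (take_nth x0) // last_rcons.
by rewrite -[in RHS](cat_take_drop i.+1 p) last_cat (take_nth x0) // last_rcons.
Qed.

End Distance.

(** * The stacking theorem: potential, pebble values, chain moves *)

Section StackingTheorem.
Variables (V : finType) (e : rel V).
Hypothesis conn : graph_connected e.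
Implicit Types (C : configuration V) (val : V -> nat).
Local Notation dist := (dist e).
Local Notation stack_cost := (stack_cost e).

(** A move from [u] to [v] removes 2 * 2^d(g,u) and adds 2^d(g,v), which is no larger because d(g,v)
    <= d(g,u) + 1. *)
Lemma potential_noninc g C C' : pebbling_moves e C C' ->
  \sum_u C' u * 2 ^ dist g u <= \sum_u C u * 2 ^ dist g u.
Proof.
elim=> [{}C {}C' [u [v [euv Cu ->]]]|{}C //|C1 C2 C3 _ H1 _ H2]; last first.
  exact: leq_trans H2 H1.
rewrite (eq_bigr (fun w => (C w - 2 * (w == u)) * 2 ^ dist g w
                        + (w == v) * 2 ^ dist g w)); last first.
  by move=> w _; rewrite ffunE mulnDl.
rewrite big_split /= [X in _ + X](bigD1 v) //= eqxx mul1n.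
rewrite [X in _ + (_ + X)]big1 ?addn0; last by move=> w /negPf ->.
rewrite (bigD1 u) //= [leqRHS](bigD1 u) //= eqxx muln1.
rewrite (eq_bigr (fun w => C w * 2 ^ dist g w)); last first.
  by move=> w /negPf ->; rewrite muln0 subn0.
have: 2 ^ dist g v <= 2 * 2 ^ dist g u.
  rewrite -expnS leq_exp2l // (leq_trans (dist_triangle conn u _ _)) //.
  by rewrite -addn1 leq_add2l dist_edge.
have: (C u - 2) * 2 ^ dist g u + 2 * 2 ^ dist g u = C u * 2 ^ dist g u.
  by rewrite -mulnDl subnK.
move=> <- le; rewrite -addnA -[leqRHS]addnA leq_add2l addnC.
exact: leq_add.
Qed.

(** With [N] pebbles stacked on [g] the potential starts at [N], while a configuration covering
    every vertex has potential at least [stack_cost g]. *)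
Lemma stack_cost_le N g : covers_from e N -> stack_cost g <= N.
Proof.
move=> /(_ [ffun w => N * (w == g)]) [|C' [/(potential_noninc g) le C'gt0]].
  rewrite /weight (bigD1 g) //= ffunE eqxx muln1 leq_addr //.
apply: leq_trans (leq_trans le _).
  by apply: leq_sum => u _; rewrite leq_pmull.
rewrite (bigD1 g) //= ffunE eqxx distvv // !muln1 big1 ?addn0 //.
by move=> u /negPf ug; rewrite ffunE ug muln0.
Qed.

(** Writing a constant as an indicator sum lets totals that differ by it be compared vertex by
    vertex. *)
Lemma sum_at (u : V) k : \sum_v (v == u) * k = k.
Proof.
by rewrite (bigD1 u) //= eqxx mul1n big1 ?addn0 // => v /negPf ->.
Qed.

(** Two pebbles leave [u]; at each inner vertex the arriving pebble joins one already there, and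
    this pair pays for the next move. One pebble thus reaches the end, and each inner vertex loses
    one. *)
Lemma chain_move u v p C : path e u (v :: p) -> uniq (u :: v :: p) ->
  1 < C u -> (forall w, w \in belast v p -> 0 < C w) ->
  exists2 C', pebbling_moves e C C' &
    forall w, C' w = (if w == last v p then (C w).+1 else
                      if w == u then C w - 2 else
                      if w \in belast v p then (C w).-1 else C w).
Proof.
elim: p u v C => [|v' p IHp] u v C.
  rewrite /= andbT => euv; rewrite inE andbT => uv Cu _.
  eexists; first by apply: rt_step; exists u, v; split.
  move=> w; rewrite ffunE /=.
  have [->|wv] := eqVneq w v; first by rewrite eq_sym (negPf uv) subn0 addn1.
  by rewrite addn0; case: eqP; rewrite ?subn0.
move=> /= /andP[euv pathp] /and3P[uNp vNp uniqp] Cu Cpos.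
pose C1 : configuration V := [ffun w => C w - 2 * (w == u) + (w == v)].
have uv : u != v by apply: contraNneq uNp => ->; rewrite inE eqxx.
have C1v : 1 < C1 v.
  by rewrite ffunE eq_sym (negPf uv) eqxx subn0 addn1 ltnS Cpos ?inE ?eqxx.
have sub w : w \in belast v' p -> w \in v' :: p.
  by rewrite [v' :: p]lastI mem_rcons inE orbC => ->.
have [|w wp|C' CC' C'E] := IHp v v' C1 pathp _ C1v.
- by rewrite /= vNp.
- rewrite ffunE.
  have wv : w != v by apply: contraNneq vNp => <-; apply: sub.
  have wu : w != u by apply: contraNneq uNp => <-; rewrite inE sub ?orbT.
  by rewrite (negPf wv) (negPf wu) subn0 addn0 Cpos // inE wp orbT.
exists C'; first by apply: rt_trans CC'; apply: rt_step; exists u, v.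
move=> w; rewrite C'E ffunE inE.
have [wl|wl] := eqVneq w (last v' p).
  have wp : w \in v' :: p by rewrite wl mem_last.
  have wv : w != v by apply: contraNneq vNp => <-.
  have wu : w != u by apply: contraNneq uNp => <-; rewrite inE wp orbT.
  by rewrite (negPf wv) (negPf wu) subn0 addn0.
have [->|wv] := eqVneq w v.
  by rewrite eq_sym (negPf uv) /= subn0; lia.
have [->|wu] := eqVneq w u.
  rewrite muln1 addn0 ifN //; apply: contra uNp => /sub up.
  by rewrite inE up orbT.
by rewrite subn0 addn0.
Qed.

(* [val v] counts the initial pebbles that were spent on the pebbles now at
   [v]; the total value is thus conserved by the moves. *)
Definition valued C val :=
  [/\ forall v, C v = 0 -> val v = 0,
      forall v, 1 < C v -> val v = C v
    & forall g v, 1 < C g -> C v = 1 -> val v <= 2 ^ dist g v].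

(* Choose [f] with at least two pebbles and [t] empty as close as possible. On a
   shortest path from [f] to [t] the i-th inner vertex holds exactly one pebble,
   whose value is at most 2^i; so a pebble passed along the whole path arrives
   with value at most 2 + 2 + 4 + ... + 2^(d-1) = 2^d, and d <= d(g,t) for
   every other [g] with at least two pebbles. *)
Lemma chain_step C val f0 t0 : valued C val -> 1 < C f0 -> C t0 = 0 ->
  exists C' val' f, [/\ pebbling_moves e C C', weight C' < weight C,
    valued C' val', \sum_v val' v = \sum_v val v &
    forall v, C' v <= 1 -> val' v <= (C' v == 1) * 2 ^ dist f v].
Proof.
move=> [val0 valfat val1] Cf0 Ct0.
pose P (x : V * V) := (1 < C x.1) && (C x.2 == 0).
have P0 : P (f0, t0) by rewrite /P /= Cf0 Ct0.
case: (arg_minnP (fun x => dist x.1 x.2) P0) => -[f t] /= /andP[/= Cf /eqP Ct] min.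
have {min} closest f' t' : 1 < C f' -> C t' = 0 -> dist f t <= dist f' t'.
  by move=> Cf' Ct'; apply: (min (f', t')); rewrite /P /= Cf' Ct'.
have [[|v p] [qP qt quniq qsize]] := geodesic conn f t.
  by move: Cf; rewrite -[f]/(last f [::]) qt Ct.
have ft : f != t by apply: contraTneq Cf => ->; rewrite Ct.
have nth_in i : i < size p -> nth f (belast v p) i = nth f (v :: p) i.
  by move=> ip; rewrite [v :: p]lastI nth_rcons size_belast ip.
have far i : i < size p -> dist f (nth f (belast v p) i) <= i.+1.
  move=> ip; rewrite nth_in //; apply: (dist_le conn).
  by apply: walk_take qP _; apply: ltnW.
(* An empty inner vertex would be closer to [f] than [t] is, and one with two pebbles would be
   closer to [t] than [f] is; both contradict the choice of the pair. *)
have inner w : w \in belast v p -> C w = 1.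
  move=> /(nthP f)[i]; rewrite size_belast => ip wE.
  have := far i ip; rewrite wE => fw.
  case Cw: (C w) => [|[|k]] //.
    have := closest f w Cf Cw; rewrite -qsize /= => le.
    by have := leq_trans le fw; rewrite ltnNge ip.
  have := walk_drop f qP (ltnW ip : i < size (v :: p)).
  rewrite -nth_in // wE qt => /(dist_le conn) wt.
  have Cw1 : 1 < C w by rewrite Cw.
  have := leq_trans (closest w t Cw1 Ct) wt; rewrite -qsize /=; lia.
have tl : last v p = t by [].
have [|C' CC' C'E] := chain_move qP quniq Cf.
  by move=> w /inner ->.
have tNb : t \notin belast v p.
  by move: quniq; rewrite cons_uniq lastI rcons_uniq tl => /and3P[].
have fNb : f \notin belast v p.
  by move: quniq; rewrite cons_uniq lastI mem_rcons inE negb_or => /andP[/andP[]].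
(* The pebble arriving at [t] inherits the value 2 of the pair taken from [f] and the total value
   [S] of the inner pebbles spent on the way. *)
pose S := \sum_(w in belast v p) val w.
pose val' w := if w == t then 2 + S else if w == f then val f - 2 else
               if w \in belast v p then 0 else val w.
have S_le : 2 + S <= 2 ^ dist f t.
  have -> : 2 ^ dist f t = 2 + \sum_(i < size p) 2 ^ i.+1.
    rewrite -qsize /=; elim: (size p) => [|k IHk]; first by rewrite big_ord0.
    by rewrite big_ord_recr /= addnA -IHk addnn -mul2n -expnS.
  rewrite leq_add2l /S -big_uniq; last first.
    by move: quniq; rewrite cons_uniq lastI rcons_uniq => /and3P[].
  rewrite (big_nth f) size_belast big_mkord leq_sum // => i _.
  apply: leq_trans (_ : 2 ^ dist f (nth f (belast v p) i) <= _).
    by apply: val1 => //; apply/inner/mem_nth; rewrite size_belast.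
  by rewrite leq_exp2l // far.
exists C', val', f; split=> //.
(* With 2 credited to [f] on the left and 1 to [t] on the right, the inequality holds at each single
   vertex. *)
- have : weight C' + 2 <= weight C + 1.
    rewrite -(sum_at f 2) -[X in _ <= _ + X](sum_at t 1) -!big_split /=.
    apply: leq_sum => w _; rewrite C'E tl; case: (eqVneq w t) => [->|wt].
      by rewrite eq_sym (negPf ft); lia.
    by case: (eqVneq w f) => [->|wf]; [|case: ifP]; lia.
  lia.
- split.
  + move=> w; rewrite C'E /val' tl; case: eqP => // _; case: eqP => [->|_].
      by rewrite valfat.
    by case: ifP => // _ /val0.
  + move=> w; rewrite C'E /val' tl; case: eqP => [->|_]; first by rewrite Ct.
    case: eqP => [->|_]; first by rewrite valfat.
    by case: ifP => [/inner ->|_ /valfat].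
  + move=> g w; rewrite C'E /val' tl; case: (eqVneq g t) => [->|gt].
      by rewrite Ct.
    move=> C'g; have {C'g} Cg : 1 < C g.
      move: C'g; case: eqP => [->//|_]; case: ifP => [/inner ->|] //.
    rewrite C'E tl; case: (eqVneq w t) => [-> _|wt].
      by apply: leq_trans S_le _; rewrite leq_exp2l // closest.
    case: (eqVneq w f) => [-> Cf2|wf].
      by rewrite valfat // Cf2 expn_gt0.
    by case: ifP => [/inner ->|_ Cw1] //; apply: val1.
(* On the left 2 + [S] is refunded to [f] and the inner vertices, on the right it is placed at [t];
   the sums then agree termwise. *)
- apply/eqP; rewrite -(eqn_add2r (2 + S)) -{1}(sum_at f 2) {1}/S.
  rewrite (big_mkcond (mem (belast v p))) /= -[X in _ == _ + X](sum_at t) -!big_split /=.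
  apply/eqP/eq_bigr => w _; rewrite /val'; case: (eqVneq w t) => [->|wt].
    by rewrite eq_sym (negPf ft) (negPf tNb) val0 // mul0n mul1n addn0.
  case: (eqVneq w f) => [->|wf].
    by rewrite (negPf fNb) valfat // mul1n mul0n !addn0 subnK.
  by rewrite !mul0n add0n addn0; case: ifP; rewrite ?addn0.
- move=> w; rewrite C'E /val' tl; case: (eqVneq w t) => [->|wt].
    by rewrite Ct eqxx mul1n.
  case: (eqVneq w f) => [->|wf].
    by rewrite valfat // distvv // muln1; case: (C f - 2) => [|[]].
  case: ifP => [_|_ Cw]; rewrite ?leq0n //.
  case Cw1: (C w) Cw => [|[|]] //; first by rewrite val0.
  by rewrite eqxx mul1n val1.
Qed.

(** Induction on a bound for the weight, which each [chain_step] lowers. Once no vertex holds two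
    pebbles, the last source [f] bounds every value by 2^d(f,v), so an empty vertex would push the
    total value below [stack_cost f]. *)
Lemma coverable_valued k C val : weight C <= k -> valued C val ->
  (exists f, 1 < C f) -> (forall g, stack_cost g <= \sum_v val v) ->
  coverable e C.
Proof.
elim: k C val => [|k IHk] C val.
  rewrite leqn0 /weight sum_nat_eq0 => /forallP C0 _ [f].
  by have := C0 f; rewrite implyTb => /eqP ->.
move=> Ck valC [f0 Cf0] cost.
have [/forallP C1|/forallPn[t0]] := boolP [forall v, 0 < C v].
  by exists C; split=> //; apply: rt_refl.
rewrite -eqn0Ngt => /eqP Ct0.
have [C' [val' [f [CC' ltC' valC' sumval bound]]]] := chain_step valC Cf0 Ct0.
suff [D [C'D D1]] : coverable e C' by exists D; split=> //; apply: rt_trans C'D.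
have [/existsP fat|/existsPn noFat] := boolP [exists g, 1 < C' g].
  by apply: IHk valC' fat _ => [|g]; rewrite ?sumval // -ltnS (leq_trans ltC').
have {bound} bound v : val' v <= (C' v == 1) * 2 ^ dist f v.
  by apply: bound; rewrite leqNgt noFat.
exists C'; split=> [|v]; first exact: rt_refl.
rewrite lt0n; apply: contraTneq (cost f) => C'v; rewrite -sumval -ltnNge.
rewrite /stack_cost (bigD1 v) //= [ltnRHS](bigD1 v) //= -addSn leq_add //.
  by rewrite (leq_ltn_trans (bound v)) // C'v expn_gt0.
by apply: leq_sum => u _; apply: leq_trans (bound u) _; case: (_ == 1); rewrite ?mul1n.
Qed.

(** Initially every pebble has value 1, so [C] serves as its own valuation. If no vertex holds two
    pebbles, [C] is already a cover: an empty [v] would make the weight smaller than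
    [stack_cost v]. *)
Lemma stacking N : (forall g, stack_cost g <= N) -> covers_from e N.
Proof.
move=> cost C NC.
have [/existsP fat|/existsPn noFat] := boolP [exists g, 1 < C g].
  apply: (coverable_valued (leqnn _) (val := C)) fat _ => [|g].
    by split=> // g v _ ->; rewrite expn_gt0.
  exact: leq_trans NC.
exists C; split=> [|v]; first exact: rt_refl.
rewrite lt0n; apply: contraTneq (leq_trans (cost v) NC) => Cv; rewrite -ltnNge.
rewrite /stack_cost /weight (bigD1 v) //= [ltnRHS](bigD1 v) //= Cv distvv //.
rewrite -addSn leq_add // leq_sum // => u _; rewrite (@leq_trans 1) ?expn_gt0 //.
by rewrite leqNgt noFat.
Qed.

Lemma cover_pebbling_number_eq g : irreflexive e ->
  (forall v, stack_cost v <= stack_cost g) ->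
  cover_pebbling_number e = stack_cost g.
Proof.
move=> irr max; have [cov min] := cover_pebbling_numberP irr conn.
by apply/eqP; rewrite eqn_leq min ?stack_cost_le //; apply: stacking.
Qed.

End StackingTheorem.

(** * Copies and corners of the glued graph *)

Definition corner (G : corner_graph) (i : 'I_3) : G :=
  match val i with
  | 0 => top_corner G | 1 => left_corner G | _ => right_corner G end.

Section GlueDistance.
Variable G : corner_graph.
Hypothesis corners : distinct_corners G.

(** Numbering copies and corners alike turns the three identifications into one symmetric rule:
    corner [j] of copy [i] is corner [i] of copy [j]. *)
Definition copy (i : 'I_3) (u : G) : glue G :=
  glue_class (match val i with
              | 0 => in_top u | 1 => in_left u | _ => in_right u end).

Lemma copyP p : exists i u, p = copy i u.
Proof.
have pE : p = glue_class (val p) by apply/val_inj/esym/eqP/(valP p).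
rewrite pE; case: (val p) => [[u|u]|u].
- by exists (@Ordinal 3 0 isT), u.
- by exists (@Ordinal 3 1 isT), u.
- by exists (@Ordinal 3 2 isT), u.
Qed.

Lemma corner_glue i : corner (glue G) i = copy i (corner G i).
Proof. by case: i => [[|[|[|//]]] ?]. Qed.

Lemma corner_inj : injective (corner G).
Proof.
move: corners; rewrite /distinct_corners /= !inE negb_or andbT.
move=> /andP[/andP[/eqP tl /eqP tr] /eqP lr].
by move=> [[|[|[|//]]] ?] [[|[|[|//]]] ?]; rewrite /corner /= => E;
  apply: val_inj => //=; exfalso; congruence.
Qed.

Lemma copy_eqP i j u v : copy i u = copy j v <->
  (i = j /\ u = v) \/ [/\ i != j, u = corner G j & v = corner G i].
Proof.
have ordE (a b : 'I_3) : a = b :> nat -> a = b := @val_inj _ _ _ a b.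
split=> [/eqP|].
  rewrite glue_class_eq // /identified !inE => /predU1P[|].
    case: i j => [[|[|[|//]]] ?] [[|[|[|//]]] ?] //= [->];
      by left; split=> //; apply: ordE.
  case: i j => [[|[|[|//]]] ?] [[|[|[|//]]] ?];
    by case/orP => /or3P[] /eqP[] // -> ->; right; split.
case=> [[-> ->] //|[ij -> ->]]; apply/eqP; rewrite glue_class_eq // /identified !inE.
by case: i j ij => [[|[|[|//]]] ?] [[|[|[|//]]] ?] //= _; rewrite eqxx ?orbT.
Qed.

Lemma copy_corner i j : copy i (corner G j) = copy j (corner G i).
Proof. by apply/copy_eqP; have [->|] := eqVneq i j; [left|right]. Qed.

Lemma copy_inj i : injective (copy i).
Proof. by move=> u v /copy_eqP[[]|[]]; rewrite ?eqxx. Qed.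

Lemma glue_edgeP p q : edge (glue G) p q <->
  exists i u v, [/\ edge G u v, p = copy i u & q = copy i v].
Proof.
split=> [/existsP[x /existsP[y /and3P[]]]|[i [u [v [uv -> ->]]]]].
  case: x y => [[u|u]|u] [[v|v]|v] //= uv /eqP <- /eqP <-.
  - by exists (@Ordinal 3 0 isT), u, v.
  - by exists (@Ordinal 3 1 isT), u, v.
  - by exists (@Ordinal 3 2 isT), u, v.
apply/existsP; case: i => [[|[|[|//]]] ?].
- by exists (in_top u); apply/existsP; exists (in_top v); rewrite /= uv !eqxx.
- by exists (in_left u); apply/existsP; exists (in_left v); rewrite /= uv !eqxx.
- by exists (in_right u); apply/existsP; exists (in_right v); rewrite /= uv !eqxx.
Qed.

(** A shared vertex is counted only in the first of the copies [i], [j], [k] that contains it; the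
    corners it occupies in later copies are left out. *)
Lemma sum_glue i j k (f : glue G -> nat) : uniq [:: i; j; k] ->
  \sum_p f p = \sum_u f (copy i u) + \sum_(u | u != corner G i) f (copy j u)
    + \sum_(u | (u != corner G i) && (u != corner G j)) f (copy k u).
Proof.
rewrite /= !inE negb_or andbT => /andP[/andP[ij ik] jk].
pose I := [set copy i u | u in G].
pose J := [set copy j u | u in [set u | u != corner G i]].
pose K := [set copy k u | u in [set u | (u != corner G i) && (u != corner G j)]].
have IJ : [disjoint I & J].
  apply/pred0P => p; apply/negP => /andP[/imsetP[u _ ->] /imsetP[v]].
  rewrite inE => /eqP vi /copy_eqP[[ijE]|[_ _ //]]; by rewrite ijE eqxx in ij.
have IJK : [disjoint [predU I & J] & K].
  apply/pred0P => p; apply/negP => /= /andP[+ /imsetP[v]].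
  rewrite !inE => + /andP[/eqP vi /eqP vj] pE; rewrite pE.
  case/orP => /imsetP[u _] /copy_eqP[[ijE]|[_ ? ?]] //.
    by rewrite ijE eqxx in ik.
  by rewrite ijE eqxx in jk.
have cover p : p \in I :|: J :|: K.
  have [l [u ->]] := copyP p.
  have : [|| l == i, l == j | l == k].
    by move: i j k l ij ik jk {I J K IJ IJK}
      => [[|[|[|//]]] ?] [[|[|[|//]]] ?] [[|[|[|//]]] ?] [[|[|[|//]]] ?].
  have [->|ui] := eqVneq u (corner G i).
    by rewrite copy_corner !inE imset_f.
  case/or3P => /eqP->.
  - by rewrite !inE imset_f.
  - by rewrite !inE [copy j u \in J]imset_f ?orbT ?inE.
  - have [->|uj] := eqVneq u (corner G j).
      rewrite copy_corner !inE [copy j _ \in J]imset_f ?orbT //.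
      by rewrite inE (inj_eq corner_inj) eq_sym.
    by rewrite !inE [copy k u \in K]imset_f ?orbT // inE ui.
rewrite (eq_bigl [in [predU [predU I & J] & K]]); last first.
  by move=> p; have := cover p; rewrite !inE => ->.
rewrite bigU //= bigU //=.
rewrite !big_imset /=; try by move=> u v _ _ /copy_inj.
congr (_ + _ + _); apply: eq_bigl => u; by rewrite inE.
Qed.

(** * Distances in the glued graph *)

Hypothesis conn : graph_connected (edge G).
Local Notation dG := (dist (edge G)).
Local Notation dH := (dist (edge (glue G))).
Let gconn : graph_connected (edge (glue G)) := glue_connected conn.

Lemma dist_copy i u v : dH (copy i u) (copy i v) <= dG u v.
Proof.
have [p [pP <- <-]] := dist_walk conn u v; apply: (dist_le gconn).
exists (map (copy i) p); rewrite last_map size_map; split=> //.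
apply: homo_path pP => a b ab; apply/glue_edgeP; by exists i, a, b.
Qed.

Variable D : nat.
Hypothesis corner_dist : forall i j : 'I_3, i != j -> dG (corner G i) (corner G j) = D.
Hypothesis dist_corner : forall v i, dG v (corner G i) <= D.

(* The distance from corner [i] of the glued graph to the image of [u] in copy
   [j], defined before passing to the quotient. *)
Let height (i j : 'I_3) u := if j == i then dG (corner G i) u
                    else D + dG (corner G i) u.

(** The height is 0 at the start of a walk from corner [i] and grows by at most 1 along each
    edge. *)
Lemma height_le i j u : height i j u <= dH (copy i (corner G i)) (copy j u).
Proof.
have [p [pP pl <-]] := dist_walk gconn (copy i (corner G i)) (copy j u).
elim/last_ind: p j u pP pl => [|p q IHp] j u /=.
  move=> _ /copy_eqP[[<- <-]|[ij /corner_inj ijE]].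
    by rewrite /height eqxx distvv.
  by rewrite ijE eqxx in ij.
rewrite rcons_path last_rcons size_rcons => /andP[pP /glue_edgeP[l [a [b [ab pl ->]]]]].
(* The end of the walk may be presented in another copy than its last edge. Both presentations have
   the same height, since distinct corners are at distance exactly [D]. *)
move=> bu; apply: leq_trans (_ : height i l b <= _).
  move/copy_eqP: bu => [[-> ->] //|[lj -> ->]].
  rewrite /height; have [ji|ji] := eqVneq j i; have [li|li] := eqVneq l i => //.
  - by rewrite ji li eqxx in lj.
  - by rewrite ji distvv // addn0 corner_dist // eq_sym.
  - by rewrite li distvv // addn0 corner_dist // eq_sym.
  - by rewrite !corner_dist // eq_sym.
have := IHp _ _ pP pl; rewrite /height.
have : dG (corner G i) b <= dG (corner G i) a + 1.
  apply: leq_trans (dist_triangle conn a _ _) _.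
  by rewrite leq_add2l; apply: dist_edge.
rewrite addn1; case: ifP => _ ab1 ap; first exact: leq_trans ab1 _.
by apply: leq_trans (_ : D + (dG (corner G i) a).+1 <= _); rewrite ?leq_add2l ?addnS.
Qed.

(** The route through the corner shared by copies [i] and [j] gives the upper bound, the height the
    lower one. *)
Lemma gdist_corner i j u : i != j ->
  dH (copy i (corner G i)) (copy j u) = D + dG (corner G i) u.
Proof.
move=> ij; apply/eqP; rewrite eqn_leq; apply/andP; split.
  apply: leq_trans (dist_triangle gconn (copy i (corner G j)) _ _) _.
  apply: leq_add; first by rewrite (leq_trans (dist_copy _ _ _)) ?corner_dist.
  by rewrite copy_corner dist_copy.
by have := height_le i j u; rewrite /height eq_sym (negPf ij).
Qed.

Lemma gdist_corner_copy i u :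
  dH (copy i (corner G i)) (copy i u) = dG (corner G i) u.
Proof.
by apply/eqP; rewrite eqn_leq dist_copy; have := height_le i i u; rewrite /height eqxx.
Qed.

Lemma glue_corner_dist i j : i != j ->
  dH (corner (glue G) i) (corner (glue G) j) = D + D.
Proof. by move=> ij; rewrite !corner_glue gdist_corner ?corner_dist. Qed.

Lemma glue_dist_corner p i : dH p (corner (glue G) i) <= D + D.
Proof.
have [j [u ->]] := copyP p; rewrite corner_glue.
have [->|ji] := eqVneq j i.
  by rewrite (leq_trans (dist_copy _ _ _)) // (leq_trans (dist_corner _ _)) ?leq_addr.
apply: leq_trans (dist_triangle gconn (copy j (corner G i)) _ _) _.
apply: leq_add; first by rewrite (leq_trans (dist_copy _ _ _)).
by rewrite copy_corner (leq_trans (dist_copy _ _ _)).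
Qed.

(** * Stacking costs in the glued graph *)

Local Notation costG := (stack_cost (edge G)).
Local Notation costH := (stack_cost (edge (glue G))).

Lemma cost_corner i :
  costG (corner G i) = 1 + \sum_(u | u != corner G i) 2 ^ dG (corner G i) u.
Proof. by rewrite /stack_cost (bigD1 (corner G i)) //= distvv. Qed.

Lemma cost_corners i j : i != j -> costG (corner G i) = 1 + (2 ^ D +
  \sum_(u | (u != corner G i) && (u != corner G j)) 2 ^ dG (corner G i) u).
Proof.
move=> ij; rewrite cost_corner (bigD1 (corner G j)) /= ?corner_dist //.
by rewrite (inj_eq corner_inj) eq_sym.
Qed.

Lemma other_copies (i : 'I_3) : exists j k, uniq [:: i; j; k].
Proof.
by case: i => [[|[|[|//]]] lt3];
  [exists (@Ordinal 3 1 isT), (@Ordinal 3 2 isT)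
  |exists (@Ordinal 3 0 isT), (@Ordinal 3 2 isT)
  |exists (@Ordinal 3 0 isT), (@Ordinal 3 1 isT)].
Qed.

(** With c the cost of corner [i] in [G], the copies contribute c, 2^D (c - 1) and 2^D (c - 1 -
    2^D), as the omitted corners are at distances 0 and [D] from corner [i]. The additive form
    avoids truncated subtraction. *)
Lemma cost_glue_corner i : costH (corner (glue G) i) + (2 ^ (D + D) + 2 ^ D.+1)
  = (1 + 2 ^ D.+1) * costG (corner G i).
Proof.
have [j [k ijk]] := other_copies i; rewrite corner_glue /stack_cost (sum_glue _ ijk).
move: ijk; rewrite /= !inE negb_or andbT => /andP[/andP[ij ik] jk].
rewrite (eq_bigr (fun u => 2 ^ dG (corner G i) u)); last first.
  by move=> u _; rewrite gdist_corner_copy.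
rewrite -/(costG (corner G i)).
have far l (A : pred G) : i != l ->
    \sum_(u | A u) 2 ^ dH (copy i (corner G i)) (copy l u)
    = 2 ^ D * \sum_(u | A u) 2 ^ dG (corner G i) u.
  by move=> il; rewrite big_distrr; apply: eq_bigr => u _; rewrite gdist_corner // expnD.
rewrite !far //; have := cost_corners ij; have := cost_corner i.
move: (costG _) (\sum_(_ | _) _) (\sum_(_ | _) _) => c X Y.
rewrite expnD expnS; lia.
Qed.

(** The same decomposition, starting from the copy [i] that contains [p]: this copy costs at most
    [L], and the others are reached through shared corners at distance at most [D], hence cost no
    more than from corner [i]. *)
Lemma cost_glue_le L p : (forall u, costG u <= L) ->
  costH p + (2 ^ (D + D) + 2 ^ D.+1) <= (1 + 2 ^ D.+1) * L.
Proof.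
move=> maxL; have [i [v ->]] := copyP p.
have [j [k ijk]] := other_copies i; rewrite /stack_cost (sum_glue _ ijk).
move: ijk; rewrite /= !inE negb_or andbT => /andP[/andP[ij ik] jk].
have via l u : 2 ^ dH (copy i v) (copy l u) <= 2 ^ D * 2 ^ dG (corner G i) u.
  rewrite -expnD leq_exp2l //.
  apply: leq_trans (dist_triangle gconn (copy i (corner G l)) _ _) _.
  apply: leq_add; last by rewrite copy_corner dist_copy.
  exact: leq_trans (dist_copy _ _ _) (dist_corner _ _).
have own : \sum_u 2 ^ dH (copy i v) (copy i u) <= L.
  apply: leq_trans (maxL v); apply: leq_sum => u _.
  by rewrite leq_exp2l // dist_copy.
have first : \sum_(u | u != corner G i) 2 ^ dH (copy i v) (copy j u)
    <= 2 ^ D * \sum_(u | u != corner G i) 2 ^ dG (corner G i) u.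
  by rewrite big_distrr leq_sum.
have second : \sum_(u | (u != corner G i) && (u != corner G j))
      2 ^ dH (copy i v) (copy k u)
    <= 2 ^ D * \sum_(u | (u != corner G i) && (u != corner G j))
      2 ^ dG (corner G i) u.
  by rewrite big_distrr leq_sum.
have := cost_corners ij; have := cost_corner i; have := maxL (corner G i) => cL cX cY.
apply: leq_trans (leq_add (leq_add (leq_add own first) second) (leqnn _)) _.
move: (costG _) (\sum_(_ | _) _) (\sum_(_ | _) _) cL cX cY => c Y X cL cX cY.
(* The bounds multiplied by 2^D supply all nonlinear products, so that the goal becomes linear in
   them. *)
have : 2 ^ D * c <= 2 ^ D * L by rewrite leq_mul2l cL orbT.
have : 2 ^ D * c = 2 ^ D * X + 2 ^ D by rewrite cX addnC mulnDr muln1.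
have : 2 ^ D * c = 2 ^ D * Y + 2 ^ D * 2 ^ D + 2 ^ D.
  rewrite cY !mulnDr; lia.
rewrite expnD expnS; lia.
Qed.

End GlueDistance.

(** The three claims are proved by one induction: the maximal cost, attained at the top corner,
    serves as [L] in [cost_glue_le], whose bound [cost_glue_corner] then shows to be attained at the
    new top corner. *)
Lemma sierpinski_cost m (G := iter m glue triangle) :
  [/\ forall i j : 'I_3, i != j -> dist (edge G) (corner G i) (corner G j) = 2 ^ m,
      forall v i, dist (edge G) v (corner G i) <= 2 ^ m
    & forall v, stack_cost (edge G) v <= stack_cost (edge G) (top_corner G)].
Proof.
elim: m @G => [|m IHm] G.
  have conn := @sierpinski_connected 1; rewrite /sierpinski /= in conn.
  have d1 (u v : triangle) : dist (edge triangle) u v = (u != v).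
    have [->|uv] := eqVneq u v; first by rewrite distvv.
    apply/eqP; rewrite eqn_leq dist_edge ?dist_gt0 //.
  split=> [i j ij|v i|v]; rewrite ?d1.
  - have -> // : corner G i != corner G j.
    by move: i j ij => [[|[|[|//]]] ?] [[|[|[|//]]] ?].
  - by case: eqP.
  - rewrite /stack_cost; rewrite !big_ord_recl !big_ord0 !d1.
    by move: v => [[|[|[|//]]] ?].
have [D1 D2 D3] := IHm.
have conn := @sierpinski_connected m.+1; have corners := sierpinski_corners m.+1.
rewrite expnS mul2n -addnn /G /=; split.
- by move=> i j; apply: glue_corner_dist.
- by move=> v i; apply: glue_dist_corner.
- move=> v; have := cost_glue_le corners conn D1 D2 v D3.
  have := cost_glue_corner corners conn D1 (@Ordinal 3 0 isT).
  by rewrite [corner _ _]/= => <-; rewrite leq_add2r.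
Qed.

Theorem theorem10 (n : nat) (hn : (1 <= n)%N) :
  ((cover_pebbling_number (edge (sierpinski n.+1)))%:Z
   = (1 + 2 ^+ (2 ^ n.-1 + 1)) * (cover_pebbling_number (edge (sierpinski n)))%:Z
     - (2 ^+ (2 ^ n) + 2 ^+ (2 ^ n.-1 + 1)))%R.
Proof.
have eqF m : cover_pebbling_number (edge (sierpinski m.+1)) =
    stack_cost (edge (sierpinski m.+1)) (top_corner (sierpinski m.+1)).
  apply: cover_pebbling_number_eq; first exact: sierpinski_connected.
    exact: sierpinski_edge_irr.
  by have [] := sierpinski_cost m.
case: n hn => // m _; rewrite !eqF.
have [D1 _ _] := sierpinski_cost m.
have := cost_glue_corner (sierpinski_corners m.+1) (@sierpinski_connected m.+1)
  D1 (@Ordinal 3 0 isT).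
(* Here D = 2^m and n = m + 1, so D + D = 2^n and D + 1 = 2^(n-1) + 1 are the exponents of the
   recursion. *)
rewrite [corner _ _]/= -[glue _]/(sierpinski m.+2) addnn -mul2n -expnS /= addn1.
move: (stack_cost _ _) (stack_cost _ _) => x y E.
have pow k : (2 ^+ k = (2 ^ k)%N%:Z :> int)%R by rewrite -GRing.natrX natz.
(* Moving the subtracted term to the left reduces the integer identity to [E] over the natural
   numbers. *)
rewrite !pow; apply: (canRL (GRing.addrK _)).
by rewrite -!PoszD E PoszM.
Qed.
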